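(* Let $P$ be a convex polygon in the plane with no two edges parallel. Then any two LMAPs in $P$ interleave.
   Context: $P$ is regarded as a compact set (boundary $\partial P$ plus interior); its edges are regarded as open segments (not containing their endpoints). A parallelogram lies in $P$ if all four corners lie in $P$. A parallelogram $A_0A_1A_2A_3$ lying in $P$ is locally maximal if there is $\delta>0$ such that every parallelogram $B_0B_1B_2B_3$ lying in $P$ with $|A_iB_i|<\delta$ for all $i$ has area at most that of $A_0A_1A_2A_3$. It is slidable if two of its corners lie in the same (open) edge of $P$, non-slidable otherwise. An LMAP is a locally maximal, non-slidable parallelogram lying in $P$ (every LMAP is inscribed, i.e. its corners lie on $\partial P$). For $X,X'\in\partial P$, $[X\circlearrowright X']$ denotes the closed portion of $\partial P$ traversed when moving clockwise along $\partial P$ from $X$ to $X'$ (just $\{X\}$ if $X=X'$). Two $k$-gons $A=A_0\ldots A_{k-1}$ and $B=B_0\ldots B_{k-1}$ inscribed in $P$, with $A_0,\ldots,A_{k-1}$ in clockwise order and $B_0,\ldots,B_{k-1}$ in clockwise order, interleave if (1) for every $i$ some corner of $B$ lies in $[A_i\circlearrowright A_{i+1}]$, and (2) for every $i$ some corner of $A$ lies in $[B_i\circlearrowright B_{i+1}]$ (subscripts modulo $k$). *)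

(* Defs.v *)
From HB Require Import structures.
From mathcomp Require Import all_boot all_order all_algebra.
From mathcomp Require Import reals.
Set Implicit Arguments. Unset Strict Implicit. Unset Printing Implicit Defensive.
Import Order.TTheory GRing.Theory Num.Theory.
Local Open Scope ring_scope.

Section Polygon.
Variable R : realType.

Definition pt := (R * R)%type.
Definition padd (p q : pt) : pt := (p.1 + q.1, p.2 + q.2).
Definition psub (p q : pt) : pt := (p.1 - q.1, p.2 - q.2).
Definition pscale (a : R) (p : pt) : pt := (a * p.1, a * p.2).
Definition cross (p q : pt) : R := p.1 * q.2 - p.2 * q.1.
Definition dist2 (p q : pt) : R := (p.1 - q.1) ^+ 2 + (p.2 - q.2) ^+ 2.

(* A polygon is given by its n vertices v 0, ..., v (n-1) listed in
   clockwise order; the edges are [v i, v (ordS i)]. *)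
Variable n : nat.
Variable v : 'I_n -> pt.

Definition edge_dir (i : 'I_n) : pt := psub (v (ordS i)) (v i).

(* convex polygon, vertices in clockwise order: every other vertex lies
   strictly to the right of each directed edge *)
Definition convex_polygon_cw : Prop :=
  (3 <= n)%N /\
  forall i j : 'I_n, j != i -> j != ordS i ->
    cross (edge_dir i) (psub (v j) (v i)) < 0.

Definition no_parallel_edges : Prop :=
  forall i j : 'I_n, i != j -> cross (edge_dir i) (edge_dir j) != 0.

Definition inP (x : pt) : Prop :=
  forall i : 'I_n, cross (edge_dir i) (psub x (v i)) <= 0.

Definition in_open_edge (i : 'I_n) (x : pt) : Prop :=
  exists2 l : R, 0 < l < 1 & x = padd (v i) (pscale l (edge_dir i)).

(* clockwise boundary parameter: X = point of parameter t in [0, n) *)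
Definition bparam (X : pt) (t : R) : Prop :=
  exists i : 'I_n, exists2 l : R, 0 <= l < 1 &
    t = (i : nat)%:R + l /\ X = padd (v i) (pscale l (edge_dir i)).

Definition on_boundary (X : pt) : Prop := exists t, bparam X t.

Definition in_cw_arc (X X' Y : pt) : Prop :=
  exists tX tX' tY, [/\ bparam X tX, bparam X' tX', bparam Y tY &
    if tX <= tX' then tX <= tY <= tX' else (tX <= tY) || (tY <= tX')].

Definition cw_inscribed (k : nat) (A : 'I_k -> pt) : Prop :=
  exists t : 'I_k -> R, (forall i, bparam (A i) (t i)) /\
    exists r : 'I_k, forall j : nat, (j.+1 < k)%N ->
      t (iter j (@ordS k) r) < t (iter j.+1 (@ordS k) r).

Definition interleave (k : nat) (A B : 'I_k -> pt) : Prop :=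
  (forall i : 'I_k, exists j : 'I_k, in_cw_arc (A i) (A (ordS i)) (B j)) /\
  (forall i : 'I_k, exists j : 'I_k, in_cw_arc (B i) (B (ordS i)) (A j)).

Definition c4 (i : nat) : 'I_4 := inord i.

Definition parallelogram (A : 'I_4 -> pt) : Prop :=
  padd (A (c4 0)) (A (c4 2)) = padd (A (c4 1)) (A (c4 3)).

Definition area (A : 'I_4 -> pt) : R :=
  `| cross (psub (A (c4 1)) (A (c4 0))) (psub (A (c4 3)) (A (c4 0))) |.

Definition lies_in_P (A : 'I_4 -> pt) : Prop := forall i, inP (A i).

Definition locally_maximal (A : 'I_4 -> pt) : Prop :=
  parallelogram A /\ lies_in_P A /\
  exists2 d : R, 0 < d &
    forall B : 'I_4 -> pt, parallelogram B -> lies_in_P B ->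
      (forall i, dist2 (A i) (B i) < d ^+ 2) -> area B <= area A.

Definition slidable (A : 'I_4 -> pt) : Prop :=
  exists i j : 'I_4, i != j /\
    exists e : 'I_n, in_open_edge e (A i) /\ in_open_edge e (A j).

Definition LMAP (A : 'I_4 -> pt) : Prop :=
  locally_maximal A /\ ~ slidable A.

End Polygon.

(* Main.v *)
Require Import Defs.
From HB Require Import structures.
From mathcomp Require Import all_boot all_order all_algebra.
From mathcomp Require Import reals.
From mathcomp Require Import ring lra zify.
Set Implicit Arguments. Unset Strict Implicit. Unset Printing Implicit Defensive.
Import Order.TTheory GRing.Theory Num.Theory.
Local Open Scope ring_scope.

(* Pair the corners of the two parallelograms as z_i = B_i - A_i and put
   s_i = z_i x z_(i+1). Moving A, or B, linearly towards another parallelogram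
   contained in P, local maximality gives first-order inequalities, from which
   - s_i + s_(i+2) <= 0 for every i;
   - s_i > 0 if one of the sides A_i A_(i+1), B_i B_(i+1) is nested beyond the
     other, since otherwise the inner side could be translated outwards;
   - s_(i-1) and s_i are never both positive.
   Hence at most one pair of corresponding sides is nested, and then the two
   corners opposite to it satisfy A_j <> B_j, since A_j = B_j would make
   s_(j-1) = s_j = 0. If the arc from A_3 to A_0 missed B, then
   all corners of B would lie strictly between A_0 and A_3, so that the sides
   A_3 A_0 and B_3 B_0 would be nested; comparing A_1 with B_1 and A_2 with B_2
   along the boundary always yields a second nested pair, or else A_1 = B_1 or
   A_2 = B_2. *)


(** * Orientation of triples of points, and first-order optimality of parallelograms in a convex
    set *)

Section PlaneGeometry.
Variable R : realType.
Implicit Types (A B C U X Y Z W : pt R) (l : R).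

Definition orient X Y Z : R := cross (psub Y X) (psub Z X).

Definition lerp l X Y : pt R := padd X (pscale l (psub Y X)).

Definition convex_set (K : pt R -> Prop) : Prop :=
  forall X Y l, 0 <= l <= 1 -> K X -> K Y -> K (lerp l X Y).

Lemma orient_rot X Y Z : orient Y Z X = orient X Y Z.
Proof. rewrite /orient /cross /=; ring. Qed.

Lemma orientXX Y Z : orient Y Y Z = 0.
Proof. rewrite /orient /cross /=; ring. Qed.

Lemma orientYY X Y : orient X Y Y = 0.
Proof. rewrite /orient /cross /=; ring. Qed.

Lemma orient_lerp l X X' Y Z :
  orient (lerp l X X') Y Z = (1 - l) * orient X Y Z + l * orient X' Y Z.
Proof. rewrite /orient /cross /=; ring. Qed.

Lemma orient_lerp_le0 l X X' Y Z : 0 <= l <= 1 ->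
  orient X Y Z <= 0 -> orient X' Y Z <= 0 -> orient (lerp l X X') Y Z <= 0.
Proof. by rewrite orient_lerp => /andP[l0 l1] h h'; nra. Qed.

Lemma orient_lerp_same (U V : pt R) l r Z :
  orient (lerp l U V) (lerp r U V) Z = (r - l) * orient U V Z.
Proof. by rewrite /orient /cross /=; ring. Qed.

Lemma lerp_inj (U V : pt R) l r : U <> V -> lerp l U V = lerp r U V -> l = r.
Proof.
case: U V => [u1 u2] [w1 w2] ne.
rewrite /lerp /padd /pscale /psub /= => -[h1 h2].
have [//|lr] := eqVneq l r; case: ne.
have d : l - r != 0 by rewrite subr_eq0.
by congr (_, _); apply: (mulfI d); lra.
Qed.

(** Seen from X, the points Y, Z, W lie in one open half-plane bounded by the line XU, where angular
    order is transitive; algebraically this is a Plücker relation. *)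
Lemma orient_trans X U Y Z W :
  orient X U Y < 0 -> orient X U Z < 0 -> orient X U W < 0 ->
  orient X Y Z < 0 -> orient X Z W < 0 -> orient X Y W < 0.
Proof.
move=> uy uz uw yz zw.
have plucker : orient X U Z * orient X Y W =
    orient X U Y * orient X Z W + orient X U W * orient X Y Z.
  by rewrite /orient /cross /=; ring.
by nra.
Qed.

(** The point W off the line XZ only serves to measure: [orient X _ W] is affine and vanishes at X,
    so the ratio of its values at Y and Z is the coordinate of Y. *)
Lemma collinear_lerp X Y Z W : orient X Y Z = 0 -> orient X Z W != 0 ->
  Y = lerp (orient X Y W / orient X Z W) X Z.
Proof.
move=> col nz.
have plucker (f : R * R -> R) : f = fst \/ f = snd ->
    (f Y - f X) * orient X Z W =
    orient X Y W * (f Z - f X) - orient X Y Z * (f W - f X).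
  by case=> ->; rewrite /orient /cross /=; ring.
have coord (f : R * R -> R) : f = fst \/ f = snd ->
    f Y = f X + orient X Y W / orient X Z W * (f Z - f X).
  move=> hf; have := plucker f hf; rewrite col mul0r subr0 => h.
  by rewrite mulrAC -h mulfK // subrKC.
rewrite /lerp /padd /pscale /psub /= -(coord fst) -?(coord snd) //; try tauto.
by case: (Y).
Qed.

Section Stationary.
Variable K : pt R -> Prop.
Hypothesis Kconv : convex_set K.

(* First-order optimality at the parallelogram with corner A0 and neighbouring
   corners A1, A3: the derivative of the area of A + t (C - A) at t = 0 is
   nonpositive. *)
Definition stationary A0 A1 A3 : Prop :=
  forall C0 C1 C2 C3, K C0 -> K C1 -> K C2 -> K C3 ->
    padd C0 C2 = padd C1 C3 ->
    cross (psub C3 C0) (psub A1 A0) + cross (psub A3 A0) (psub C1 C0) <=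
    2 * cross (psub A3 A0) (psub A1 A0).

Lemma parallelogram_corner A0 A1 A2 A3 : padd A0 A2 = padd A1 A3 ->
  A2 = psub (padd A1 A3) A0.
Proof.
case: A0 A1 A2 A3 => [? ?] [? ?] [? ?] [? ?] [] /= h1 h2.
by congr (_, _) => /=; lra.
Qed.

Lemma stationary_rot A0 A1 A2 A3 : padd A0 A2 = padd A1 A3 ->
  stationary A0 A1 A3 -> stationary A1 A2 A0.
Proof.
move=> /parallelogram_corner -> st C1 C2 C3 C0 k1 k2 k3 k0 eC.
have eC' : padd C0 C2 = padd C1 C3.
  by move: eC; rewrite /padd => -[h1 h2]; congr (_, _); lra.
have := st _ _ _ _ k0 k1 k2 k3 eC'.
move: eC' => /parallelogram_corner ->.
rewrite /cross /=; lra.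
Qed.

(** Signed area is a quadratic form on parallelograms, and the left side of [stationary] is its
    polar form. Adding the two optimality inequalities shows that the form is nonnegative at B - A,
    where it equals minus the sum bounded here. *)
Lemma stationary_opposite A0 A1 A2 A3 B0 B1 B2 B3 :
  K A0 -> K A1 -> K A2 -> K A3 -> K B0 -> K B1 -> K B2 -> K B3 ->
  padd A0 A2 = padd A1 A3 -> padd B0 B2 = padd B1 B3 ->
  stationary A0 A1 A3 -> stationary B0 B1 B3 ->
  cross (psub B0 A0) (psub B1 A1) + cross (psub B2 A2) (psub B3 A3) <= 0.
Proof.
move=> a0 a1 a2 a3 b0 b1 b2 b3 pA pB stA stB.
have := stA _ _ _ _ b0 b1 b2 b3 pB; have := stB _ _ _ _ a0 a1 a2 a3 pA.
rewrite (parallelogram_corner pA) (parallelogram_corner pB) /cross /=; lra.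
Qed.

(* If the lines A0 X and A1 Y did not converge beyond the side A0 A1, that side
   could be translated outwards inside K. *)
Lemma stationary_nested A0 A1 A2 A3 X Y :
  K A0 -> K A1 -> K A2 -> K A3 -> K X -> K Y -> padd A0 A2 = padd A1 A3 ->
  stationary A0 A1 A3 -> orient A0 X A1 < 0 -> orient A0 Y A1 < 0 ->
  0 < cross (psub X A0) (psub Y A1).
Proof.
move=> a0 a1 a2 a3 kx ky pA st oX oY; rewrite ltNge; apply/negP => s_le0.
set b := - orient A0 X A1; set b1 := - orient A0 Y A1.
set s := - cross (psub X A0) (psub Y A1).
have b_gt0 : 0 < b by rewrite oppr_gt0.
have b1_gt0 : 0 < b1 by rewrite oppr_gt0.
have s_ge0 : 0 <= s by rewrite oppr_ge0.
have bb_gt0 : 0 < b + b1 by lra.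
have bbs_gt0 : 0 < b + b1 + s by lra.
(* [b] and [b1] measure the heights of X and Y over the line A0 A1. Since [t * b = t1 * b1], the
   points [C0] and [lerp t1 A1 Y] are at equal height; as [s >= 0], the chord between them is at
   least as long as A0 A1, and [r] marks on it the translate [C1] of A1. *)
set t := b1 / (b + b1); set t1 := b / (b + b1).
set r := (b + b1) / (b + b1 + s).
have t01 : 0 <= t <= 1 by rewrite /t divr_ge0 ?ler_pdivrMr //; lra.
have t101 : 0 <= t1 <= 1 by rewrite /t1 divr_ge0 ?ler_pdivrMr //; lra.
have r01 : 0 <= r <= 1 by rewrite /r divr_ge0 ?ler_pdivrMr //; lra.
have t_gt0 : 0 < t by rewrite divr_gt0.
pose C0 := lerp t A0 X.
have k0 : K C0 by apply: Kconv.
pose C1 := lerp r C0 (lerp t1 A1 Y).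
have k1 : K C1 by apply: Kconv => //; apply: Kconv.
have eC1 : C1 = padd A1 (pscale t (psub X A0)).
  have n1 : b + b1 != 0 by rewrite lt0r_neq0.
  have n2 : b + b1 + s != 0 by rewrite lt0r_neq0.
  move: n1 n2; rewrite /C1 /C0 /r /t /t1 /s /b /b1 /orient /cross.
  rewrite /lerp /padd /pscale /psub /= => n1 n2.
  congr (_, _); field; apply/andP; split; [exact: n1 | exact: n2 | exact: n1 | exact: n2].
have eC : padd C0 A2 = padd C1 A3.
  rewrite eC1 (parallelogram_corner pA) /C0 /lerp /padd /pscale /psub /=.
  by congr (_, _); ring.
have := st _ _ _ _ k0 k1 a2 a3 eC; rewrite eC1.
have -> : cross (psub A3 C0) (psub A1 A0) +
   cross (psub A3 A0) (psub (padd A1 (pscale t (psub X A0))) C0) =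
   2 * cross (psub A3 A0) (psub A1 A0) + t * b.
  by rewrite /C0 /b /orient /cross /lerp /padd /pscale /psub /=; ring.
have : 0 < t * b by rewrite mulr_gt0.
lra.
Qed.

(* With zi = Bi - Ai: z0 lies in the cone of z1 and z3, so the corners A1, A0,
   A3 can move towards their partners with A2 fixed, and B1, B0, B3 backwards with B2 fixed;
   the two derivatives of the area have a positive sum. *)
Lemma stationary_adjacent A0 A1 A2 A3 B0 B1 B2 B3 :
  K A0 -> K A1 -> K A2 -> K A3 -> K B0 -> K B1 -> K B2 -> K B3 ->
  padd A0 A2 = padd A1 A3 -> padd B0 B2 = padd B1 B3 ->
  stationary A0 A1 A3 -> stationary B0 B1 B3 ->
  0 < cross (psub B3 A3) (psub B0 A0) ->
  0 < cross (psub B0 A0) (psub B1 A1) -> False.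
Proof.
move=> a0 a1 a2 a3 b0 b1 b2 b3 pA pB stA stB.
set s3 := cross (psub B3 A3) _; set s0 := cross _ _ => s3_gt0 s0_gt0.
have opp := stationary_opposite a0 a1 a2 a3 b0 b1 b2 b3 pA pB stA stB.
set T := cross (psub B3 A3) (psub B1 A1).
have T_ge : s3 + s0 <= T.
  have -> : T = s3 + s0 -
      (cross (psub B0 A0) (psub B1 A1) + cross (psub B2 A2) (psub B3 A3)).
    rewrite (parallelogram_corner pA) (parallelogram_corner pB).
    by rewrite /T /s3 /s0 /cross /=; ring.
  lra.
have T_gt0 : 0 < T by lra.
(* Cramer's rule for z0 = l1 z1 + l3 z3; [T_ge] keeps both coefficients at most 1. *)
set l1 := s3 / T; set l3 := s0 / T.
have l101 : 0 <= l1 <= 1 by rewrite /l1 divr_ge0 ?ler_pdivrMr //; lra.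
have l301 : 0 <= l3 <= 1 by rewrite /l3 divr_ge0 ?ler_pdivrMr //; lra.
have lC1 : 0 <= 1 - l1 <= 1 by lra.
have lC3 : 0 <= 1 - l3 <= 1 by lra.
have T_neq0 : T != 0 by rewrite lt0r_neq0.
have l1T : l1 * T = s3 by rewrite divfK.
have l3T : l3 * T = s0 by rewrite divfK.
have cone (f : R * R -> R) : f = fst \/ f = snd ->
    f B0 - f A0 = l1 * (f B1 - f A1) + l3 * (f B3 - f A3).
  move=> hf; apply: (mulIf T_neq0).
  have -> : (l1 * (f B1 - f A1) + l3 * (f B3 - f A3)) * T =
            l1 * T * (f B1 - f A1) + l3 * T * (f B3 - f A3) by ring.
  by rewrite l1T l3T /T /s3 /s0 /cross; case: hf => -> /=; ring.
have cone1 := cone fst (or_introl erefl).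
have cone2 := cone snd (or_intror erefl).
have eA : padd B0 A2 = padd (lerp l1 A1 B1) (lerp l3 A3 B3).
  rewrite (parallelogram_corner pA); move: cone1 cone2.
  by rewrite /lerp /padd /pscale /psub /= => h1 h2; congr (_, _); lra.
have eB : padd A0 B2 = padd (lerp (1 - l1) A1 B1) (lerp (1 - l3) A3 B3).
  rewrite (parallelogram_corner pB); move: cone1 cone2.
  by rewrite /lerp /padd /pscale /psub /= => h1 h2; congr (_, _); lra.
have := stA _ _ _ _ b0 (Kconv l101 a1 b1) a2 (Kconv l301 a3 b3) eA.
have := stB _ _ _ _ a0 (Kconv lC1 a1 b1) b2 (Kconv lC3 a3 b3) eB.
have -> : psub (lerp l3 A3 B3) B0 = psub (psub A3 A0) (pscale l1 (psub B1 A1)).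
  move: cone1 cone2; rewrite /lerp /padd /pscale /psub /= => h1 h2.
  by congr (_, _); lra.
have -> : psub (lerp l1 A1 B1) B0 = psub (psub A1 A0) (pscale l3 (psub B3 A3)).
  move: cone1 cone2; rewrite /lerp /padd /pscale /psub /= => h1 h2.
  by congr (_, _); lra.
have -> : psub (lerp (1 - l3) A3 B3) A0 =
          padd (psub B3 B0) (pscale l1 (psub B1 A1)).
  move: cone1 cone2; rewrite /lerp /padd /pscale /psub /= => h1 h2.
  by congr (_, _); lra.
have -> : psub (lerp (1 - l1) A1 B1) A0 =
          padd (psub B1 B0) (pscale l3 (psub B3 A3)).
  move: cone1 cone2; rewrite /lerp /padd /pscale /psub /= => h1 h2.
  by congr (_, _); lra.
move=> dB dA.
have : l1 * s0 + l3 * s3 <= 0.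
  by move: dA dB; rewrite /s0 /s3 /cross /padd /pscale /psub /=; lra.
have : 0 < l1 * s0 by rewrite mulr_gt0 // divr_gt0.
have : 0 < l3 * s3 by rewrite mulr_gt0 // divr_gt0.
lra.
Qed.

End Stationary.

End PlaneGeometry.

(** * Local maximality implies first-order optimality and nonzero area *)

Section LocalMaxima.
Variables (R : realType) (n : nat) (v : 'I_n -> pt R).
Implicit Types (A B C : 'I_4 -> pt R) (X Y Z W : pt R).

Lemma inP_convex : convex_set (inP v).
Proof.
move=> X Y l /andP[l0 l1] hX hY i; have := hX i; have := hY i.
set x := cross _ _; set y := cross _ _ => x0 y0.
have -> : cross (edge_dir v i) (psub (lerp l X Y) (v i)) = (1 - l) * y + l * x.
  by rewrite /x /y /cross /=; ring.
nra.
Qed.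

Lemma locally_maximal_segment A C :
  locally_maximal v A -> parallelogram C -> lies_in_P v C ->
  exists2 e : R, 0 < e & forall t : R, 0 < t < e ->
    area (fun i => lerp t (A i) (C i)) <= area A.
Proof.
move=> [pA [inA [d d_gt0 maxA]]] pC inC.
pose M := \sum_i dist2 (A i) (C i).
have dist_ge0 i : 0 <= dist2 (A i) (C i) by rewrite addr_ge0 ?sqr_ge0.
have M_ge i : dist2 (A i) (C i) <= M.
  by rewrite /M (bigD1 i) //= lerDl sumr_ge0.
have M_ge0 : 0 <= M by rewrite sumr_ge0.
have d2_gt0 : 0 < d ^+ 2 by rewrite exprn_gt0.
(* Below this bound [t < 1] and [t * M < d ^+ 2], so the squared displacements, at most
   [t ^+ 2 * M], stay below [d ^+ 2]. *)
exists (d ^+ 2 / (d ^+ 2 + M)) => [|t /andP[t_gt0]].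
  by rewrite divr_gt0 //; lra.
rewrite ltr_pdivlMr => [t_lt|]; last by lra.
have t_le1 : t <= 1 by nra.
apply: maxA.
- move: pA pC; rewrite /parallelogram /padd => -[a1 a2] [c1 c2].
  by rewrite /lerp /padd /pscale /psub /=; congr (_, _); nra.
- by move=> i; apply: inP_convex => //; lra.
- move=> i; have -> : dist2 (A i) (lerp t (A i) (C i)) = t ^+ 2 * dist2 (A i) (C i).
    by rewrite /dist2 /=; ring.
  by have := M_ge i; have := dist_ge0 i; nra.
Qed.

(** The signed area, with the sign that is positive for corners in clockwise order. *)
Definition corner_area A : R :=
  cross (psub (A (c4 3)) (A (c4 0))) (psub (A (c4 1)) (A (c4 0))).

Lemma area_corner A : area A = `|corner_area A|.
Proof. by rewrite /area -normrN /corner_area /cross; congr `|_|; ring. Qed.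

Lemma corner_area_lerp A C t :
  corner_area (fun i => lerp t (A i) (C i)) =
  corner_area A +
  (cross (psub (C (c4 3)) (C (c4 0))) (psub (A (c4 1)) (A (c4 0))) +
   cross (psub (A (c4 3)) (A (c4 0))) (psub (C (c4 1)) (C (c4 0))) -
   2 * corner_area A) * t +
  (corner_area A + corner_area C -
   cross (psub (C (c4 3)) (C (c4 0))) (psub (A (c4 1)) (A (c4 0))) -
   cross (psub (A (c4 3)) (A (c4 0))) (psub (C (c4 1)) (C (c4 0)))) * t ^+ 2.
Proof. by rewrite /corner_area /cross /=; ring. Qed.

Lemma quadratic_slope_le0 (e q1 q2 : R) : 0 < e ->
  (forall t, 0 < t < e -> q1 * t + q2 * t ^+ 2 <= 0) -> q1 <= 0.
Proof.
move=> e_gt0 h; rewrite leNgt; apply/negP => q1_gt0.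
(* This [t] is below [e] and satisfies [|q2| * t < q1 / 2], so the linear term dominates. *)
pose t := q1 * e / (2 * (q1 + `|q2| * e)).
have q2e : 0 <= `|q2| * e by rewrite mulr_ge0 // ltW.
have t_gt0 : 0 < t by rewrite divr_gt0 ?mulr_gt0 //; lra.
have te : t * (2 * (q1 + `|q2| * e)) = q1 * e.
  by rewrite divfK // lt0r_neq0 // mulr_gt0 //; lra.
have t_lt : t < e by nra.
have := h t; rewrite t_gt0 t_lt => /(_ isT).
have q2_ge : - `|q2| <= q2 by rewrite lerNl -normrN ler_norm.
have : q1 * t + q2 * t ^+ 2 >= t * (q1 - `|q2| * t) by nra.
have : 0 < q1 - `|q2| * t.
  have : `|q2| * t * (2 * (q1 + `|q2| * e)) = q1 * (`|q2| * e) by rewrite -mulrA te; ring.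
  nra.
nra.
Qed.

Lemma quadratic_eq0 (e q1 q2 : R) : 0 < e ->
  (forall t, 0 < t < e -> q1 * t + q2 * t ^+ 2 = 0) -> q1 + q2 = 0.
Proof.
move=> e_gt0 h.
have := h (e / 2); have := h (e / 4).
have -> : 0 < e / 2 < e by lra.
have -> : 0 < e / 4 < e by lra.
move=> /(_ isT) h4 /(_ isT) h2.
have e_neq0 : e != 0 by rewrite lt0r_neq0.
have q2_0 : q2 = 0.
  apply/eqP; rewrite -[q2 == 0](mulrI_eq0 _ (mulfI (mulf_neq0 e_neq0 e_neq0))).
  by apply/eqP; nra.
have q1_0 : q1 = 0.
  by apply/eqP; rewrite -[q1 == 0](mulrI_eq0 _ (mulfI e_neq0)); apply/eqP; nra.
by rewrite q1_0 q2_0 addr0.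
Qed.

Definition quad (C0 C1 C2 C3 : pt R) (i : 'I_4) : pt R :=
  nth C0 [:: C0; C1; C2; C3] i.

Lemma quadE (C0 C1 C2 C3 : pt R) :
  [/\ quad C0 C1 C2 C3 (c4 0) = C0, quad C0 C1 C2 C3 (c4 1) = C1,
      quad C0 C1 C2 C3 (c4 2) = C2 & quad C0 C1 C2 C3 (c4 3) = C3].
Proof. by rewrite /quad /c4 !inordK. Qed.

Lemma quad_in (C0 C1 C2 C3 : pt R) : inP v C0 -> inP v C1 -> inP v C2 ->
  inP v C3 -> lies_in_P v (quad C0 C1 C2 C3).
Proof. by move=> h0 h1 h2 h3 [[|[|[|[|]]]]]. Qed.

Lemma locally_maximal_stationary A :
  locally_maximal v A -> 0 < corner_area A ->
  stationary (inP v) (A (c4 0)) (A (c4 1)) (A (c4 3)).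
Proof.
move=> maxA posA C0 C1 C2 C3 k0 k1 k2 k3 pC.
have [e0 e1 e2 e3] := quadE C0 C1 C2 C3.
have [||e e_gt0 maxe] := locally_maximal_segment (C := quad C0 C1 C2 C3) maxA.
- by rewrite /parallelogram e0 e1 e2 e3.
- exact: quad_in.
rewrite -subr_le0; apply: (quadratic_slope_le0 e_gt0) => t /maxe.
rewrite !area_corner (gtr0_norm posA) => /(le_trans (ler_norm _)).
by rewrite corner_area_lerp -addrA gerDl e0 e1 e3; apply.
Qed.

(** If A had area 0, maximality would force area 0 on the segment towards C near A. The signed area
    is quadratic along that segment, so it would vanish at C too. *)
Lemma locally_maximal_nondegenerate A C :
  locally_maximal v A -> parallelogram C -> lies_in_P v C ->
  corner_area C != 0 -> corner_area A != 0.
Proof.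
move=> maxA pC inC; apply: contra_neq => A0.
have [e e_gt0 maxe] := locally_maximal_segment maxA pC inC.
pose c := cross (psub (C (c4 3)) (C (c4 0))) (psub (A (c4 1)) (A (c4 0))) +
  cross (psub (A (c4 3)) (A (c4 0))) (psub (C (c4 1)) (C (c4 0))).
have lerpE t : corner_area (fun i => lerp t (A i) (C i)) =
    c * t + (corner_area C - c) * t ^+ 2.
  by rewrite corner_area_lerp A0 /c; ring.
rewrite -[LHS](subrKC c); apply: (quadratic_eq0 e_gt0) => t /maxe.
by rewrite !area_corner A0 normr0 normr_le0 lerpE => /eqP.
Qed.

End LocalMaxima.

(** * The boundary with an unrolled parameter, and the orientation of points in clockwise order *)

Lemma natr_floor_le (R : realType) (m k : nat) (l r : R) :
  0 <= l -> r < 1 -> m%:R + l < k%:R + r -> (m <= k)%N.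
Proof.
move=> l0 r1 h; rewrite leqNgt; apply/negP => km.
have : (k.+1)%:R <= m%:R :> R by rewrite ler_nat.
by rewrite -natr1; lra.
Qed.

Section Boundary.
Variables (R : realType) (n : nat) (v : 'I_n -> pt R) (i0 : 'I_n).
Hypothesis i0_eq0 : i0 = 0%N :> nat.
Hypothesis hconv : convex_polygon_cw v.
Implicit Types (X Y Z W : pt R) (l s t u : R).

Let n_ge3 : (3 <= n)%N. Proof. by case: hconv. Qed.

Definition vidx (m : nat) : 'I_n := iter m (@ordS n) i0.
Definition vtx (m : nat) : pt R := v (vidx m).

Lemma vidxE m : vidx m = (m %% n)%N :> nat.
Proof.
elim: m => [|m IHm]; first by rewrite /= i0_eq0 mod0n.
by rewrite [LHS]/= -/(vidx m) IHm -addn1 modnDml addn1.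
Qed.

Lemma vidx_ord (i : 'I_n) : vidx i = i.
Proof. by apply: val_inj; rewrite /= vidxE modn_small. Qed.

Lemma vtx_period m : vtx (m + n) = vtx m.
Proof. by congr v; apply: val_inj; rewrite /= !vidxE modnDr. Qed.

Lemma vidx_neq m q : (m < q < m + n)%N -> vidx q != vidx m.
Proof.
move=> /andP[mq qm]; apply/eqP => /(congr1 val) /=; rewrite !vidxE => /eqP.
rewrite eqn_mod_dvd; last exact: ltnW.
by rewrite gtnNdvd //; lia.
Qed.

Lemma vtx_edge m q : (m.+1 < q < m + n)%N ->
  orient (vtx m) (vtx m.+1) (vtx q) < 0.
Proof.
move=> hq; case: hconv => _; apply; first by apply: vidx_neq; lia.
by apply: (@vidx_neq m.+1); lia.
Qed.

Lemma vtx_edge_le m q : orient (vtx m) (vtx m.+1) (vtx q) <= 0.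
Proof.
have [e|ne] := eqVneq (vidx q) (vidx m).
  by rewrite /vtx e orient_rot orient_rot orientYY.
have [e|ne'] := eqVneq (vidx q) (ordS (vidx m)).
  by rewrite /vtx /= -/(vidx m) -e orientYY.
by apply: ltW; case: hconv => _; apply.
Qed.

Lemma vtx_inP m : inP v (vtx m).
Proof. by move=> i; have := vtx_edge_le i m; rewrite /vtx /= -/(vidx i) vidx_ord. Qed.

(** Induction on [c]: seen from vertex [a], the later vertices are all to the right of the edge to
    [a.+1], so [orient_trans] chains the triples [a, b, c] and [a, c, c.+1]. *)
Lemma vtx_orient a b c : (a < b)%N -> (b < c)%N -> (c < a + n)%N ->
  orient (vtx a) (vtx b) (vtx c) < 0.
Proof.
move=> ab; elim: c => // c IHc bc ca.
have [->|ba1] := eqVneq b a.+1; first by apply: vtx_edge; lia.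
have [cb|] := leqP c b.
  have -> : c = b by lia.
  by rewrite -orient_rot; have := @vtx_edge b (a + n); rewrite vtx_period; apply; lia.
move=> lt_bc.
apply: (@orient_trans _ _ (vtx a.+1) _ (vtx c)); try by apply: vtx_edge; lia.
  by apply: IHc => //; lia.
by rewrite -orient_rot; have := @vtx_edge c (a + n); rewrite vtx_period; apply; lia.
Qed.

Lemma vtx_orient_le a b c : (a <= b)%N -> (b <= c)%N -> (c <= a + n)%N ->
  orient (vtx a) (vtx b) (vtx c) <= 0.
Proof.
move=> ab bc ca.
have [->|ab'] := eqVneq a b; first by rewrite orientXX.
have [->|bc'] := eqVneq b c; first by rewrite orientYY.
have [->|ca'] := eqVneq c (a + n)%N.
  by rewrite vtx_period -orient_rot orientYY.
by apply/ltW/vtx_orient; lia.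
Qed.

(* Unrolling the parameter of [bparam] modulo n turns the cyclic order of the
   boundary into the order of R. *)
Definition uparam X t : Prop :=
  exists m l, [/\ 0 <= l < 1, t = m%:R + l & X = lerp l (vtx m) (vtx m.+1)].

Lemma bparam_uparam X t : bparam v X t -> uparam X t.
Proof.
move=> [i [l l01 [-> ->]]]; exists i, l; split=> //.
by rewrite /vtx /= -/(vidx i) vidx_ord.
Qed.

Lemma uparam_shift X t : uparam X t -> uparam X (t + n%:R).
Proof.
move=> [m [l [l01 -> ->]]]; exists (m + n)%N, l; split=> //.
  by rewrite natrD; ring.
by rewrite -addSn !vtx_period.
Qed.

Lemma uparam_inj X Y t : uparam X t -> uparam Y t -> X = Y.
Proof.
move=> [m [l [/andP[l0 l1] e ->]]] [k [r [/andP[r0 r1] e' ->]]].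
have mk : m = k.
  apply/eqP; rewrite eqn_leq; apply/andP; split.
    rewrite leqNgt; apply/negP => km.
    have : (k.+1)%:R <= m%:R :> R by rewrite ler_nat.
    by rewrite -natr1; lra.
  rewrite leqNgt; apply/negP => km.
  have : (m.+1)%:R <= k%:R :> R by rewrite ler_nat.
  by rewrite -natr1; lra.
by subst k; have -> : l = r by lra.
Qed.

Lemma uparam_edge X t : uparam X t ->
  exists i : 'I_n, exists l, X = lerp l (v i) (v (ordS i)).
Proof. by move=> [m [l [_ _ ->]]]; exists (vidx m), l. Qed.

Lemma uparam_inP X t : uparam X t -> inP v X.
Proof.
move=> [m [l [l01 _ ->]]]; apply: inP_convex; try exact: vtx_inP.
by lra.
Qed.

Lemma inP_orient X i : inP v X -> orient (v i) (v (ordS i)) X <= 0.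
Proof. exact. Qed.

Lemma inP_orient_vtx X m : inP v X -> orient (vtx m) (vtx m.+1) X <= 0.
Proof. exact. Qed.

(** [orient] is affine in each point, so for three distinct edges the endpoints suffice. If two of
    the points share an edge, the third lies on the inner side of that edge. *)
Lemma uparam_orient X Y Z s t u : uparam X s -> uparam Y t -> uparam Z u ->
  s < t -> t < u -> u < s + n%:R -> orient X Y Z <= 0.
Proof.
move=> hX hY hZ st tu us.
have pX := uparam_inP hX; have pY := uparam_inP hY; have pZ := uparam_inP hZ.
move: hX hY hZ => [i [l [/andP[l0 l1] es eX]]] [j [r [/andP[r0 r1] et eY]]].
move=> [k [q [/andP[q0 q1] eu eZ]]].
rewrite es et eu -addrA [l + _]addrC addrA -natrD in st tu us.
have ij := natr_floor_le l0 r1 st.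
have jk := natr_floor_le r0 q1 tu.
have ki := natr_floor_le q0 l1 us.
have [e|nij] := eqVneq i j.
  subst j; rewrite eX eY orient_lerp_same.
  by have := inP_orient_vtx i pZ; nra.
have [e|njk] := eqVneq j k.
  subst k; rewrite -orient_rot eY eZ orient_lerp_same.
  by have := inP_orient_vtx j pX; nra.
have [e|nki] := eqVneq k (i + n)%N.
  subst k; rewrite -addSn !vtx_period in eZ.
  rewrite -orient_rot -orient_rot eX eZ orient_lerp_same.
  by have := inP_orient_vtx i pY; nra.
have [l01 r01 q01] : [/\ 0 <= l <= 1, 0 <= r <= 1 & 0 <= q <= 1] by split; lra.
rewrite eX eY eZ; apply: (orient_lerp_le0 l01); rewrite -orient_rot;
  apply: (orient_lerp_le0 r01); rewrite -orient_rot;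
  apply: (orient_lerp_le0 q01); rewrite -orient_rot;
  apply: vtx_orient_le; clear -ij jk ki nij njk nki; lia.
Qed.

Lemma vtx_neq m : vtx m <> vtx m.+1.
Proof.
move=> e; have := @vtx_edge m m.+2.
by rewrite -e orientXX ltxx; lia.
Qed.

(** A point on two different half-open edges would make each start vertex lie on the line of the
    other edge. Each edge would then directly follow the other, giving n = 2. *)
Lemma uparam_neq X Y s t : uparam X s -> uparam Y t ->
  s < t -> t < s + n%:R -> X <> Y.
Proof.
move=> [i [l [/andP[l0 l1] es eX]]] [j [r [/andP[r0 r1] et eY]]] st ts eXY.
rewrite es et -addrA [l + _]addrC addrA -natrD in st ts.
have ij := natr_floor_le l0 r1 st.
have ji := natr_floor_le r0 l1 ts.
have [e|nij] := eqVneq i j.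
  subst j; have := lerp_inj (@vtx_neq i) (etrans (esym eX) (etrans eXY eY)).
  by lra.
have [e|nji] := eqVneq j (i + n)%N.
  subst j; rewrite -addSn !vtx_period in eY.
  have := lerp_inj (@vtx_neq i) (etrans (esym eX) (etrans eXY eY)).
  by lra.
have zero (U V U' V' : pt R) a b : 0 <= a -> a < 1 ->
    orient U V U' <= 0 -> orient U V V' <= 0 ->
    lerp a U' V' = lerp b U V -> ~ orient U V U' < 0.
  move=> a0 a1 hU hV e lt0.
  have : orient U V (lerp b U V) = 0 by rewrite /orient /cross /=; ring.
  have : orient U V (lerp a U' V') = (1 - a) * orient U V U' + a * orient U V V'.
    by rewrite /orient /cross /=; ring.
  by rewrite e => -> h; nra.
have j1 : (j.+1 = i + n)%N.
  apply/eqP; apply/negPn/negP => nj1.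
  apply: (zero _ _ _ _ _ _ l0 l1 (vtx_edge_le j i) (vtx_edge_le j i.+1)).
    by rewrite -eX eXY eY.
  by rewrite -(vtx_period i); apply: vtx_edge; lia.
have i1 : (j = i.+1)%N.
  apply/eqP; apply/negPn/negP => ni1.
  apply: (zero _ _ _ _ _ _ r0 r1 (vtx_edge_le i j) (vtx_edge_le i j.+1)).
    by rewrite -eY -eXY eX.
  by apply: vtx_edge; lia.
by lia.
Qed.

Lemma inP_edge_line X e : inP v X -> orient (v e) (v (ordS e)) X = 0 ->
  exists2 l, 0 <= l <= 1 & X = lerp l (v e) (v (ordS e)).
Proof.
(* [m] is the edge preceding [e]; the constraints of the edges [m] and [m.+2] cut the line of [e]
   down to the edge itself. *)
move=> pX; pose m := (e + n.-1)%N.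
have em : vidx m.+1 = e.
  by apply: ord_inj; rewrite vidxE /m -addnS prednK ?modnDr ?modn_small //; lia.
have -> : v e = vtx m.+1 by rewrite /vtx em.
have -> : v (ordS e) = vtx m.+2 by rewrite /vtx /= -em.
move=> col.
have neg0 : orient (vtx m) (vtx m.+1) (vtx m.+2) < 0 by apply: vtx_orient; lia.
have neg1 : orient (vtx m.+1) (vtx m.+2) (vtx m.+3) < 0 by apply: vtx_orient; lia.
have col' : orient (vtx m.+1) X (vtx m.+2) = 0.
  have : orient (vtx m.+1) X (vtx m.+2) = - orient (vtx m.+1) (vtx m.+2) X.
    by rewrite /orient /cross; ring.
  by rewrite col oppr0.
have := collinear_lerp col' (ltr0_neq0 neg1).
set l := _ / _ => eX; exists l => //.
have := inP_orient_vtx m.+2 pX; have := inP_orient_vtx m pX.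
rewrite eX.
have -> : orient (vtx m) (vtx m.+1) (lerp l (vtx m.+1) (vtx m.+2)) =
   l * orient (vtx m) (vtx m.+1) (vtx m.+2) by rewrite /orient /cross /=; ring.
have -> : orient (vtx m.+2) (vtx m.+3) (lerp l (vtx m.+1) (vtx m.+2)) =
   (1 - l) * orient (vtx m.+1) (vtx m.+2) (vtx m.+3) by rewrite /orient /cross /=; ring.
by move=> h1 h2; apply/andP; split; nra.
Qed.

Lemma edge_between e X Z (m : R) : inP v X -> inP v Z -> X <> Z -> 0 < m < 1 ->
  orient (v e) (v (ordS e)) X = 0 -> orient (v e) (v (ordS e)) Z = 0 ->
  in_open_edge v e (lerp m X Z).
Proof.
move=> pX pZ ne m01 oX oZ.
have [l l01 eX] := inP_edge_line pX oX; have [r r01 eZ] := inP_edge_line pZ oZ.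
have lr : l != r by apply/eqP => e'; apply: ne; rewrite eX eZ e'.
exists ((1 - m) * l + m * r).
  by move: lr; rewrite neq_lt => /orP[] ?; apply/andP; split; nra.
by rewrite eX eZ /lerp /padd /pscale /psub /=; congr (_, _); ring.
Qed.

(** Convexity gives the weak inequalities. If Y or Y' lay on the line XZ, so would the other, and
    both would then lie in one open edge, against the last hypothesis. *)
Lemma uparam_strict_side X Y Y' Z W s t t' u w :
  uparam X s -> uparam Y t -> uparam Y' t' -> uparam Z u -> uparam W w ->
  s < t -> t < t' -> t' < u -> u < w -> w < s + n%:R ->
  orient X Z W < 0 ->
  (forall e, in_open_edge v e Y -> in_open_edge v e Y' -> False) ->
  orient X Y Z < 0 /\ orient X Y' Z < 0.
Proof.
move=> hX hY hY' hZ hW st tt' t'u uw ws oW nslide.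
have oY : orient X Y Z <= 0 by apply: (uparam_orient hX hY hZ); lra.
have oY' : orient X Y' Z <= 0 by apply: (uparam_orient hX hY' hZ); lra.
have between Q q : uparam Q q -> s < q -> q < u -> orient X Q Z = 0 ->
    exists2 m, 0 < m < 1 & Q = lerp m X Z.
  move=> hQ sq qu oQ; have := collinear_lerp oQ (ltr0_neq0 oW).
  set m := _ / _ => eQ; exists m => //.
  have m_ge0 : 0 <= m.
    have : orient X Q W <= 0 by apply: (uparam_orient hX hQ hW); lra.
    have -> : orient X Q W = m * orient X Z W.
      by rewrite eQ /orient /cross /=; ring.
    by nra.
  have m_le1 : m <= 1.
    have : orient Q Z W <= 0 by apply: (uparam_orient hQ hZ hW); lra.
    have -> : orient Q Z W = (1 - m) * orient X Z W.
      by rewrite eQ /orient /cross /=; ring.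
    by nra.
  have m_neq0 : m != 0.
    apply/eqP => m0; apply: (@uparam_neq X Q s q) => //; first by lra.
    by rewrite eQ m0 /lerp /padd /pscale /= !mul0r !addr0; case: (X).
  have m_neq1 : m != 1.
    apply/eqP => m1; apply: (@uparam_neq Q Z q u) => //; first by lra.
    by rewrite eQ m1 /lerp /padd /pscale /psub /= !mul1r !subrKC; case: (Z).
  by rewrite lt_neqAle eq_sym m_neq0 m_ge0 lt_neqAle m_neq1 m_le1.
suff nboth : ~ (orient X Y Z = 0 /\ orient X Y' Z = 0).
  have oYY' : orient Y Y' Z <= 0 by apply: (uparam_orient hY hY' hZ); lra.
  have oXYY' : orient X Y Y' <= 0 by apply: (uparam_orient hX hY hY'); lra.
  split; rewrite lt_neqAle ?oY ?oY' andbT; apply/eqP => o0; apply: nboth; split=> //.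
    have [|m /andP[m0 m1] eY] := between _ _ hY st _ o0; first by lra.
    have : orient X Y Y' = - m * orient X Y' Z by rewrite eY /orient /cross /=; ring.
    by nra.
  have [||m /andP[m0 m1] eY'] := between _ _ hY' _ _ o0; try by lra.
  have : orient Y Y' Z = - (1 - m) * orient X Y Z.
    by rewrite eY' /orient /cross /=; ring.
  by nra.
move=> [oY0 oY'0].
have [|m m01 eY] := between _ _ hY st _ oY0; first by lra.
have [||m' m'01 eY'] := between _ _ hY' _ _ oY'0; try by lra.
(* X and Z lie weakly on one side of the edge line through Y. Since Y is strictly between them, that
   line contains both. *)
have [e [l eYe]] := uparam_edge hY.
have pX := uparam_inP hX; have pZ := uparam_inP hZ.
have XZ : X <> Z by apply: (uparam_neq hX hZ); lra.
have eo : orient (v e) (v (ordS e)) Y = 0.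
  by rewrite eYe /orient /cross /=; ring.
have := inP_orient e pX; have := inP_orient e pZ.
have : orient (v e) (v (ordS e)) Y =
  (1 - m) * orient (v e) (v (ordS e)) X + m * orient (v e) (v (ordS e)) Z.
  by rewrite eY /orient /cross /=; ring.
rewrite eo; case/andP: (m01) => m0 m1 sum0 oZ oX.
have oX0 : orient (v e) (v (ordS e)) X = 0 by nra.
have oZ0 : orient (v e) (v (ordS e)) Z = 0 by nra.
apply: (nslide e); first by rewrite eY; apply: edge_between.
by rewrite eY'; apply: edge_between.
Qed.

End Boundary.

(** * Two LMAPs as periodic sequences: no side of one strictly encloses a side of the other *)

Section Unrolled.
Variables (R : realType) (n : nat) (v : 'I_n -> pt R) (i0 : 'I_n).
Hypothesis i0_eq0 : i0 = 0%N :> nat.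
Hypothesis hconv : convex_polygon_cw v.

(* A clockwise inscribed LMAP as a 4-periodic sequence of corners; once around
   the polygon adds n to the boundary parameter. *)
Record unrolled (A : nat -> pt R) (a : nat -> R) : Prop := Unrolled {
  unr_param : forall k, uparam v i0 (A k) (a k);
  unr_incr : forall k, a k < a k.+1;
  unr_shift : forall k, a k.+4 = a k + n%:R;
  unr_period : forall k, A k.+4 = A k;
  unr_parallelogram : forall k, padd (A k) (A k.+2) = padd (A k.+1) (A k.+3);
  unr_stationary : forall k, stationary (inP v) (A k) (A k.+1) (A k.+3);
  unr_orient : forall k, orient (A k) (A k.+1) (A k.+2) < 0;
  unr_nslide : forall k e,
    in_open_edge v e (A k) -> in_open_edge v e (A k.+1) -> False
}.

Lemma unr_inP A a k : unrolled A a -> inP v (A k).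
Proof. by move=> hA; apply: (uparam_inP i0_eq0 hconv (unr_param hA k)). Qed.

(** The inner corners lie strictly beyond the outer side, because A is non-slidable; optimality of B
    then forbids translating that side outwards. *)
Lemma unrolled_nested A a B b i j : unrolled A a -> unrolled B b ->
  b j < a i -> a i.+1 < b j.+1 ->
  0 < cross (psub (B j) (A i)) (psub (B j.+1) (A i.+1)).
Proof.
move=> hA hB ba ab.
have -> : cross (psub (B j) (A i)) (psub (B j.+1) (A i.+1)) =
          cross (psub (A i) (B j)) (psub (A i.+1) (B j.+1)).
  by rewrite /cross /=; ring.
have := unr_incr hA i; have := unr_incr hB j.+1; have := unr_incr hB j.+2.
have := unr_incr hB j.+3; rewrite (unr_shift hB) => b3 b2 b1 a0.
have [|o1 o2] := uparam_strict_side i0_eq0 hconv (unr_param hB j) (unr_param hA i)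
  (unr_param hA i.+1) (unr_param hB j.+1) (unr_param hB j.+2) ba a0 ab b1 _
  (unr_orient hB j) (@unr_nslide _ _ hA i); first by lra.
exact: (stationary_nested (@inP_convex _ _ v) (unr_inP j hB) (unr_inP j.+1 hB)
  (unr_inP j.+2 hB) (unr_inP j.+3 hB) (unr_inP i hA) (unr_inP i.+1 hA)
  (unr_parallelogram hB j) (unr_stationary hB j)).
Qed.

Lemma unrolled_nestedC A a B b i j : unrolled A a -> unrolled B b ->
  a i < b j -> b j.+1 < a i.+1 ->
  0 < cross (psub (B j) (A i)) (psub (B j.+1) (A i.+1)).
Proof.
move=> hA hB ab ba; have := unrolled_nested hB hA ab ba.
by rewrite /cross /=; lra.
Qed.

Lemma unrolled_opposite A a B b i j : unrolled A a -> unrolled B b ->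
  cross (psub (B j) (A i)) (psub (B j.+1) (A i.+1)) +
  cross (psub (B j.+2) (A i.+2)) (psub (B j.+3) (A i.+3)) <= 0.
Proof.
move=> hA hB; apply: (@stationary_opposite _ (inP v)); try exact: (unr_inP _ hA);
  try exact: (unr_inP _ hB); try exact: (unr_parallelogram hA);
  try exact: (unr_parallelogram hB); try exact: (unr_stationary hA).
exact: (unr_stationary hB).
Qed.

Lemma unrolled_adjacent A a B b i j : unrolled A a -> unrolled B b ->
  0 < cross (psub (B j) (A i)) (psub (B j.+1) (A i.+1)) ->
  0 < cross (psub (B j.+1) (A i.+1)) (psub (B j.+2) (A i.+2)) -> False.
Proof.
(* The shared corner [i.+1] takes the role of A0, and [i], rewritten as [i.+4], that of A3; likewise
   for [j]. *)
move=> hA hB; rewrite -(unr_period hA i) -(unr_period hB j).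
apply: (@stationary_adjacent _ (inP v) (@inP_convex _ _ v) _ _ (A i.+3) _ _ _ (B j.+3));
  try exact: (unr_inP _ hA); try exact: (unr_inP _ hB).
- exact: (unr_parallelogram hA).
- exact: (unr_parallelogram hB).
- exact: (unr_stationary hA).
- exact: (unr_stationary hB).
Qed.

Lemma unrolled_not_enclosed A a B b i j : unrolled A a -> unrolled B b ->
  b j < a i -> a i.+1 < b j.+1 -> False.
Proof.
move=> hA hB ba ab.
have s0 := unrolled_nested hA hB ba ab.
have opp := unrolled_opposite i j hA hB.
have shift : b j.+4 < a i.+4 by rewrite (unr_shift hA) (unr_shift hB); lra.
have common k l : a k = b l -> psub (B l) (A k) = (0, 0).
  move=> e; have hb := unr_param hB l; rewrite -e in hb.
  rewrite (uparam_inj (unr_param hA k) hb).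
  by rewrite /psub !subrr.
(* A is behind B at the corners [i.+1], [j.+1] and ahead again at [i.+4], [j.+4]. A strict change of
   order on one side makes that side nested: it is adjacent to the first nested side, or opposite to
   it. An equality at an intermediate corner makes the opposite term 0, contradicting [opp]. *)
case: (ltgtP (a i.+2) (b j.+2)) => [ab2|ba2|e2].
- case: (ltgtP (a i.+3) (b j.+3)) => [ab3|ba3|e3].
  + have := unrolled_nestedC hA hB ab3 shift.
    rewrite (unr_period hA) (unr_period hB) => s3.
    apply: (unrolled_adjacent (i := i.+3) (j := j.+3) hA hB).
      by rewrite (unr_period hA) (unr_period hB).
    by rewrite !(unr_period hA) !(unr_period hB).
  + by have := unrolled_nestedC hA hB ab2 ba3; lra.
  + move: opp; rewrite (common _ _ e3).
    by rewrite [X in _ + X]/cross /= !mulr0 subrr; lra.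
- by apply: (unrolled_adjacent hA hB s0); apply: unrolled_nestedC hA hB ab ba2.
- move: opp; rewrite (common _ _ e2).
  by rewrite [X in _ + X]/cross /= !mul0r subrr; lra.
Qed.

Lemma unrolled_shift A a i q : unrolled A a ->
  a (i + 4 * q)%N = a i + q%:R * n%:R.
Proof.
move=> hA; elim: q => [|q IHq]; first by rewrite muln0 addn0 mul0r addr0.
by rewrite mulnS addnCA (unr_shift hA) IHq -natr1; ring.
Qed.

(** After enough turns [a k] exceeds [b 0], so the first [b j] at or after [a k] has a predecessor
    before [a k]. If this [b j] also passed [a k.+1], a side of B would enclose one of A. *)
Lemma unrolled_arc A a B b i : unrolled A a -> unrolled B b ->
  exists q j, a (i + 4 * q)%N <= b j <= a (i + 4 * q).+1.
Proof.
move=> hA hB.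
have n_ge1 : 1 <= n%:R :> R by rewrite ler1n; case: hconv; lia.
have large (x y : R) : exists q : nat, x < y + q%:R * n%:R.
  exists (Num.bound `|x - y|).
  have := archi_boundP (normr_ge0 (x - y)); have := ler_norm (x - y).
  set q := Num.bound _ => h1 h2.
  have : q%:R <= q%:R * n%:R :> R by rewrite ler_peMr.
  by lra.
have [q hq] := large (b 0%N) (a i); rewrite -(unrolled_shift i q hA) in hq.
exists q; set k := (i + 4 * q)%N in hq *.
have ex : exists j, a k <= b j.
  have [p hp] := large (a k) (b 0%N).
  by exists (0 + 4 * p)%N; rewrite (unrolled_shift 0 p hB) ltW.
case: (ex_minnP ex) => -[|j] akb jmin; first by move: akb; rewrite leNgt hq.
exists j.+1; rewrite akb leNgt; apply/negP => ba.
apply: (unrolled_not_enclosed hA hB _ ba (j := j)).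
by rewrite ltNge; apply/negP => /jmin; rewrite ltnn.
Qed.

End Unrolled.

(** * Passing from four cyclic corners to periodic sequences, and back to clockwise arcs *)

Lemma val_iter_ordS4 k (x : 'I_4) : iter k (@ordS 4) x = ((x + k) %% 4)%N :> nat.
Proof.
elim: k => [|k IHk]; first by rewrite addn0 modn_small.
by rewrite [LHS]/= IHk -addn1 modnDml addn1 addnS.
Qed.

Lemma iter_ordS4_mod k (x : 'I_4) : iter (k %% 4) (@ordS 4) x = iter k (@ordS 4) x.
Proof. by apply: ord_inj; rewrite !val_iter_ordS4 modnDmr. Qed.

Lemma iter_ordS4_reach (x y : 'I_4) : exists k, y = iter k (@ordS 4) x.
Proof.
exists (y + (4 - x))%N; apply: ord_inj; rewrite val_iter_ordS4.
by have := ltn_ord x; have := ltn_ord y; lia.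
Qed.

Lemma ordS_c4 : [/\ ordS (c4 0) = c4 1, ordS (c4 1) = c4 2 & ordS (c4 2) = c4 3].
Proof. by split; apply: ord_inj; rewrite /= /c4 !inordK. Qed.

Section UnrollLMAP.
Variables (R : realType) (n : nat) (v : 'I_n -> pt R) (i0 : 'I_n).
Hypothesis i0_eq0 : i0 = 0%N :> nat.
Hypothesis hconv : convex_polygon_cw v.

Lemma bparam_bounds X t : bparam v X t -> 0 <= t < n%:R.
Proof.
move=> [i [l /andP[l0 l1] [-> _]]].
have : (i.+1)%:R <= n%:R :> R by rewrite ler_nat.
by have := ler0n R i; rewrite -natr1; lra.
Qed.

Lemma locally_maximal_corner_area_neq0 A : locally_maximal v A -> corner_area A != 0.
Proof.
move=> maxA.
have n3 : (3 <= n)%N by case: hconv.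
pose V := vtx v i0.
have o_lt0 : orient (V 0%N) (V 1%N) (V 2%N) < 0.
  by apply: (vtx_orient i0_eq0 hconv); lia.
pose mid (X Y : pt R) := lerp 2^-1 X Y.
(* A vertex of the triangle V0 V1 V2 and the midpoints of its three sides form a nondegenerate
   parallelogram in the polygon. *)
pose C := quad (V 0%N) (mid (V 0%N) (V 1%N)) (mid (V 1%N) (V 2%N))
  (mid (V 0%N) (V 2%N)).
have [e0 e1 e2 e3] := quadE (V 0%N) (mid (V 0%N) (V 1%N))
  (mid (V 1%N) (V 2%N)) (mid (V 0%N) (V 2%N)).
apply: (@locally_maximal_nondegenerate _ _ v A C) => //.
- rewrite /parallelogram /C e0 e1 e2 e3 /mid /lerp /padd /pscale /psub /=.
  by congr (_, _); lra.
- apply: quad_in; try apply: inP_convex; try exact: (vtx_inP i0_eq0 hconv); by lra.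
rewrite /corner_area /C e0 e1 e3; apply/eqP.
have -> : forall X Y Z : pt R,
    cross (psub (lerp 2^-1 X Z) X) (psub (lerp 2^-1 X Y) X) = - (2^-1 * 2^-1 * orient X Y Z).
  by move=> X Y Z; rewrite /orient /cross /=; ring.
by move=> h; nra.
Qed.

Definition unroll (A : 'I_4 -> pt R) (r : 'I_4) (k : nat) : pt R :=
  A (iter k (@ordS 4) r).

(** [r] is meant to be the corner of least parameter, so that [k %/ 4] counts the completed
    turns. *)
Definition unroll_param (t : 'I_4 -> R) (r : 'I_4) (k : nat) : R :=
  t (iter k (@ordS 4) r) + (k %/ 4 * n)%:R.

Lemma unroll_param_incr (t : 'I_4 -> R) r :
  (forall i, 0 <= t i < n%:R) ->
  (forall j : nat, (j.+1 < 4)%N ->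
      t (iter j (@ordS 4) r) < t (iter j.+1 (@ordS 4) r)) ->
  forall k, unroll_param t r k < unroll_param t r k.+1.
Proof.
move=> bnd incr k; rewrite /unroll_param.
have [k3|k3] := ltnP (k %% 4).+1 4.
  have -> : (k.+1 %/ 4 = k %/ 4)%N by lia.
  rewrite ltrD2r -iter_ordS4_mod -[X in _ < t X]iter_ordS4_mod.
  have -> : (k.+1 %% 4 = (k %% 4).+1)%N by lia.
  exact: incr.
(* Here the sequence returns to [r]; the gain of [n] outweighs the drop of [t], whose values lie in
   [0, n). *)
have -> : (k.+1 %/ 4 * n = k %/ 4 * n + n)%N by rewrite -mulSnr; congr (_ * _)%N; lia.
rewrite natrD.
by have /andP[_ h1] := bnd (iter k (@ordS 4) r);
   have /andP[h2 _] := bnd (iter k.+1 (@ordS 4) r); lra.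
Qed.

Lemma unroll_LMAP (A : 'I_4 -> pt R) (t : 'I_4 -> R) r :
  LMAP v A -> (forall i, bparam v (A i) (t i)) ->
  (forall j : nat, (j.+1 < 4)%N ->
      t (iter j (@ordS 4) r) < t (iter j.+1 (@ordS 4) r)) ->
  unrolled v i0 (unroll A r) (unroll_param t r).
Proof.
move=> [maxA nslide] ht incr.
have a_incr := unroll_param_incr (fun i => bparam_bounds (ht i)) incr.
have a_shift k : unroll_param t r k.+4 = unroll_param t r k + n%:R.
  rewrite /unroll_param -iter_ordS4_mod -[X in _ = t X + _ + _]iter_ordS4_mod.
  have -> : (k.+4 %% 4 = k %% 4)%N by lia.
  have -> : (k.+4 %/ 4 * n = k %/ 4 * n + n)%N by rewrite -mulSnr; congr (_ * _)%N; lia.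
  by rewrite natrD addrA.
have a_param k : uparam v i0 (unroll A r k) (unroll_param t r k).
  have := bparam_uparam i0_eq0 (ht (iter k (@ordS 4) r)).
  rewrite /unroll_param; elim: (k %/ 4)%N => [|q IHq h].
    by rewrite mul0n addr0.
  rewrite mulSnr natrD addrA.
  exact: uparam_shift (IHq h).
have A_period k : unroll A r k.+4 = unroll A r k.
  rewrite /unroll -iter_ordS4_mod -[in RHS]iter_ordS4_mod.
  by have -> : (k.+4 %% 4 = k %% 4)%N by lia.
(* These properties survive a cyclic shift of the corners, so proving them at [c4 0] gives them at
   every index. *)
pose good A0 A1 A2 A3 := [/\ padd A0 A2 = padd A1 A3,
  0 < cross (psub A3 A0) (psub A1 A0) & stationary (inP v) A0 A1 A3].
have good_rot A0 A1 A2 A3 : good A0 A1 A2 A3 -> good A1 A2 A3 A0.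
  move=> [pA cA sA]; split; last exact: (stationary_rot pA sA).
    by move: pA; rewrite /padd => -[h1 h2]; congr (_, _); lra.
  by rewrite (parallelogram_corner pA); move: cA; rewrite /cross /=; lra.
have good_iter k x : good (A x) (A (ordS x)) (A (ordS (ordS x))) (A (ordS (ordS (ordS x)))) ->
   let y := iter k (@ordS 4) x in
   good (A y) (A (ordS y)) (A (ordS (ordS y))) (A (ordS (ordS (ordS y)))).
  move=> gx; elim: k => // k /= /good_rot.
  set y := iter k _ x.
  have -> : ordS (ordS (ordS (ordS y))) = y by have := iter_ordS4_mod 4 y.
  by [].
have [c01 c12 c23] := ordS_c4.
have good0 : good (A (c4 0)) (A (c4 1)) (A (c4 2)) (A (c4 3)).
  (* Clockwise order gives the weak inequality; nondegeneracy makes it strict. *)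
  have cA : 0 < corner_area A.
    rewrite lt_neqAle eq_sym locally_maximal_corner_area_neq0 //=.
    have [k ek] := iter_ordS4_reach r (c4 0).
    have := uparam_orient i0_eq0 hconv (a_param k) (a_param k.+1) (a_param k.+3).
    have := a_incr k; have := a_incr k.+1; have := a_incr k.+2; have := a_incr k.+3.
    rewrite a_shift => i3 i2 i1 i00 o.
    have : orient (unroll A r k) (unroll A r k.+1) (unroll A r k.+3) <= 0 by apply: o; lra.
    rewrite /unroll !iterS -ek c01 c12 c23.
    by rewrite /corner_area /orient /cross /=; lra.
  split=> //; first by case: maxA.
  exact: locally_maximal_stationary.
have goodk k : good (unroll A r k) (unroll A r k.+1) (unroll A r k.+2) (unroll A r k.+3).
  have [m em] := iter_ordS4_reach (c4 0) (iter k (@ordS 4) r).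
  rewrite /unroll !iterS em; apply: good_iter.
  by rewrite c01 c12 c23.
split=> //.
- by move=> k; case: (goodk k).
- by move=> k; case: (goodk k).
- move=> k; case: (goodk k) => pA cA _.
  by rewrite (parallelogram_corner pA); move: cA; rewrite /orient /cross /=; lra.
- move=> k e h1 h2; apply: nslide.
  exists (iter k (@ordS 4) r), (iter k.+1 (@ordS 4) r); split; last by exists e.
  apply/eqP => /(congr1 (@nat_of_ord 4)); rewrite !val_iter_ordS4.
  by lia.
Qed.

Lemma LMAP_cw_arc A B : LMAP v A -> LMAP v B ->
  cw_inscribed v A -> cw_inscribed v B ->
  forall i : 'I_4, exists j : 'I_4, in_cw_arc v (A i) (A (ordS i)) (B j).
Proof.
move=> hA hB [tA [ptA [rA incrA]]] [tB [ptB [rB incrB]]] i.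
have uA := unroll_LMAP hA ptA incrA; have uB := unroll_LMAP hB ptB incrB.
have [m em] := iter_ordS4_reach rA i.
have [q [j]] := unrolled_arc i0_eq0 hconv m uA uB.
set k := (m + 4 * q)%N => /andP[].
have ek : i = iter k (@ordS 4) rA.
  by rewrite em -iter_ordS4_mod -[RHS]iter_ordS4_mod; congr (iter _ _ _); lia.
set y := iter j (@ordS 4) rB.
have := unr_incr uA k; have := unr_incr uA k.+1; have := unr_incr uA k.+2.
have := unr_incr uA k.+3; rewrite (unr_shift uA) => h3 h2 h1 h0.
have hk : unroll_param tA rA k.+1 < unroll_param tA rA k + n%:R by lra.
move: h0 hk; rewrite /unroll_param iterS -ek -/y {h1 h2 h3}.
have bX := bparam_bounds (ptA i); have bX' := bparam_bounds (ptA (ordS i)).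
have bY := bparam_bounds (ptB y).
have turn (c d : nat) : (c < d)%N -> (c * n)%:R + n%:R <= (d * n)%:R :> R.
  by move=> cd; rewrite -natrD ler_nat -mulSnr leq_mul2r cd orbT.
move=> h0 hk hl hr.
exists y, (tA i), (tA (ordS i)), (tB y); split=> //.
(* Either the arc stays within one turn, or it passes the origin of the parameter; these are the two
   branches of [in_cw_arc]. In the second case B's corner belongs to the turn of [k] or to the next
   one. *)
have [e|e] : (k.+1 %/ 4 = k %/ 4 \/ k.+1 %/ 4 = (k %/ 4).+1)%N by lia.
- rewrite e in h0 hk hr; rewrite ifT; last by lra.
  case: (ltngtP (j %/ 4) (k %/ 4)) => [/turn|/turn|ejk]; try by lra.
  by rewrite ejk in hl hr; lra.
- rewrite e mulSnr natrD in h0 hk hr; rewrite leNgt ifF; last by apply/negbF; lra.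
  case: (ltngtP (j %/ 4) (k %/ 4)) => [/turn|kj|ejk]; first by lra.
    apply/orP; right; case: (ltngtP (j %/ 4) (k %/ 4).+1) => [|/turn|ejk]; first by lia.
      by rewrite mulSnr natrD; lra.
    by rewrite ejk mulSnr natrD in hl hr; lra.
  by apply/orP; left; rewrite ejk in hl hr; lra.
Qed.

End UnrollLMAP.

Theorem theorem3 (R : realType) (n : nat) (v : 'I_n -> pt R)
  (hconv : convex_polygon_cw v) (hpar : no_parallel_edges v)
  (A B : 'I_4 -> pt R)
  (hA : LMAP v A) (hB : LMAP v B)
  (hAcw : cw_inscribed v A) (hBcw : cw_inscribed v B) :
  interleave v A B.
Proof.
have n_gt0 : (0 < n)%N by case: hconv => n3 _; apply: leq_trans n3.
by split; apply: (@LMAP_cw_arc R n v (Ordinal n_gt0)).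
Qed.
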